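(* Let $G$ be the group with presentation $$\langle a,b,c,t \mid ac=ca,\ bc=cb,\ act=tac,\ bct=tbc\rangle$$ and let $S_2=\{a,b,c,t\}$. Then the pair $(G,S_2)$ does not satisfy minimal almost convexity (MAC).
   Context: For a group $G$ with finite generating set $S$, the Cayley graph $\Gamma=\Gamma(G,S)$ has vertex set $G$ and an edge joining $g$ and $gs$ for each $g\in G$, $s\in S$. Regard $\Gamma$ as a metric space $\tilde\Gamma$ in which each edge is a segment of length $1$ (points are the vertices and the interior points of edges), and let $d(u,v)$ be the length of a shortest path from $u$ to $v$ (path metric). Thus $d(g_1,g_2)$, for $g_1,g_2\in G$, is the length of a shortest word over $S\cup S^{-1}$ representing $g_1^{-1}g_2$. Write $|z|=d(1,z)$. For $r\geq 0$ put $Sph(r)=\{z\in\tilde\Gamma: |z|=r\}$ and $\overline{B(r)}=\{z\in\tilde\Gamma:|z|\leq r\}$. Paths between vertices are taken to be sequences of joined edges, with length the number of edges. For $r_0$ a positive integer and $f:\mathbb{N}\to\mathbb{N}$, the pair $(G,S)$ satisfies the almost convexity condition $\mathrm{AC}_{f,r_0}$ if: whenever $r\in\mathbb{Z}$ satisfies $r>r_0$ and $u,v\in Sph(r)$ satisfy $d(u,v)\leq 2$, there is a path between $u$ and $v$ that is contained in $\overline{B(r)}$ and has length at most $f(r)$. The pair $(G,S)$ satisfies minimal almost convexity (MAC) if it satisfies $\mathrm{AC}_{f,r_0}$ for some $r_0>0$, where $f(x)=2x-1$. *)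

(* Defs.v *)
From HB Require Import structures.
From mathcomp Require Import all_boot all_order all_algebra finmap.
From mathcomp Require Import generic_quotient boolp classical_sets reals.

Set Implicit Arguments.
Unset Strict Implicit.
Unset Printing Implicit Defensive.

Import Order.TTheory GRing.Theory Num.Theory.

(* The letter (i, true) stands for the generator i, (i, false) for its
   inverse. *)
Definition word (I : Type) : Type := seq (I * bool).

Section Presentation.

Variables (I : choiceType) (rels : seq (word I * word I)).

(* A relation (u, v) is the equation u = v. *)
Inductive pres_eq : word I -> word I -> Prop :=
| pres_refl w : pres_eq w w
| pres_sym u v : pres_eq u v -> pres_eq v u
| pres_trans u v w : pres_eq u v -> pres_eq v w -> pres_eq u w
| pres_cat u1 v1 u2 v2 :
    pres_eq u1 v1 -> pres_eq u2 v2 -> pres_eq (u1 ++ u2) (v1 ++ v2)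
| pres_cancel i b : pres_eq [:: (i, b); (i, ~~ b)] [::]
| pres_rel u v : (u, v) \in rels -> pres_eq u v.

Definition pres_eqb : rel (word I) := fun u v => `[< pres_eq u v >].

Lemma pres_eqb_refl : reflexive pres_eqb.
Proof. by move=> w; apply/asboolP; exact: pres_refl. Qed.

Lemma pres_eqb_sym : symmetric pres_eqb.
Proof. by move=> u v; apply/asboolP/asboolP => /pres_sym. Qed.

Lemma pres_eqb_trans : transitive pres_eqb.
Proof.
move=> v u w /asboolP uv /asboolP vw; apply/asboolP; exact: pres_trans uv vw.
Qed.

Canonical pres_equiv :=
  EquivRel pres_eqb pres_eqb_refl pres_eqb_sym pres_eqb_trans.

Local Open Scope quotient_scope.

Definition presented : Type := {eq_quot pres_equiv}.

HB.instance Definition _ := Choice.on presented.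
HB.instance Definition _ := EqQuotient.on presented.

Definition eval_word (w : word I) : presented := \pi_presented w.

Definition word_inv (w : word I) : word I :=
  rev [seq (x.1, ~~ x.2) | x <- w].

Definition pres_one : presented := eval_word [::].
Definition pres_mul (x y : presented) : presented :=
  eval_word (repr x ++ repr y).
Definition pres_inv (x : presented) : presented :=
  eval_word (word_inv (repr x)).

Lemma eval_wordP u v : eval_word u = eval_word v <-> pres_eq u v.
Proof.
by split=> [/eqmodP/asboolP|h] //; apply/eqmodP/asboolP.
Qed.

Lemma repr_eval w : pres_eq (repr (eval_word w)) w.
Proof. by apply/eval_wordP; rewrite /eval_word reprK. Qed.

Lemma eval_word_surj (x : presented) : exists w, x = eval_word w.
Proof. by exists (repr x); rewrite /eval_word reprK. Qed.

Lemma eval_cat u v : eval_word (u ++ v) = pres_mul (eval_word u) (eval_word v).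
Proof.
by apply/eval_wordP/pres_sym; apply: pres_cat; exact: repr_eval.
Qed.

Lemma word_inv_cons x w : word_inv (x :: w) = word_inv w ++ [:: (x.1, ~~ x.2)].
Proof. by rewrite /word_inv /= rev_cons cats1. Qed.

Lemma word_invK : involutive word_inv.
Proof.
move=> w; rewrite /word_inv map_rev revK -map_comp -[RHS]map_id.
by apply: eq_map => -[i b] /=; rewrite negbK.
Qed.

Lemma word_invr w : pres_eq (w ++ word_inv w) [::].
Proof.
elim: w => [|[i b] w IH]; first exact: pres_refl.
rewrite word_inv_cons -cat1s -catA (catA w).
apply: pres_trans (pres_cancel i b).
have -> : [:: (i, b); (i, ~~ b)] = [:: (i, b)] ++ ([::] ++ [:: (i, ~~ b)]) by [].
apply: pres_cat (pres_refl _) _.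
exact: pres_cat IH (pres_refl _).
Qed.

Lemma pres_mulA : associative pres_mul.
Proof.
move=> x y z.
have [u ->] := eval_word_surj x; have [v ->] := eval_word_surj y.
by have [w ->] := eval_word_surj z; rewrite -!eval_cat catA.
Qed.

Lemma pres_mul1 : left_id pres_one pres_mul.
Proof. by move=> x; have [w ->] := eval_word_surj x; rewrite -eval_cat. Qed.

Lemma pres_mulr1 : right_id pres_one pres_mul.
Proof.
by move=> x; have [w ->] := eval_word_surj x; rewrite -eval_cat cats0.
Qed.

Lemma pres_mulrV : right_inverse pres_one pres_inv pres_mul.
Proof.
move=> x; rewrite -{1}(reprK x) -/(eval_word _) -eval_cat.
by apply/eval_wordP; exact: word_invr.
Qed.

Lemma pres_mulVr : left_inverse pres_one pres_inv pres_mul.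
Proof.
move=> x; rewrite -{2}(reprK x) -/(eval_word _) -eval_cat.
by apply/eval_wordP; rewrite -{2}[repr x]word_invK; exact: word_invr.
Qed.

HB.instance Definition _ := isGroup.Build presented
  pres_mulA pres_mul1 pres_mulr1 pres_mulVr pres_mulrV.

Definition pres_gen (i : I) : presented := eval_word [:: (i, true)].

End Presentation.

Section Cayley.

Variables (R : realType) (G : groupType) (S : {fset G}).

Local Open Scope ring_scope.

Definition generating : Prop :=
  forall g : G, exists w : seq (S * bool),
    g = (\prod_(x <- w) (if x.2 then val x.1 else (val x.1)^-1))%g.

Definition edge : Type := (G * S)%type.

Definition edge_src (e : edge) : G := e.1.
Definition edge_tgt (e : edge) : G := (e.1 * val e.2)%g.

Inductive point : Type :=
| Vertex of G
| Interior of edge & {x : R | 0 < x < 1}.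

(* [on_edge e x p]: p is the point at parameter x of the closed segment e,
   parametrised by [0, 1] from its source to its target. *)
Definition on_edge (e : edge) (x : R) (p : point) : Prop :=
  match p with
  | Vertex g => (x = 0 /\ g = edge_src e) \/ (x = 1 /\ g = edge_tgt e)
  | Interior e' y => e' = e /\ x = sval y
  end.

(* [polygonal p q l]: a path of length l from p to q made of finitely many
   pieces, each running along a single closed edge. *)
Inductive polygonal (p : point) : point -> R -> Prop :=
| polygonal_nil : polygonal p p 0
| polygonal_rcons q q' e x y l :
    polygonal p q l -> on_edge e x q -> on_edge e y q' ->
    polygonal p q' (l + `|y - x|).

(* Junk value 0 when there is no path, which cannot happen if S generates G. *)
Definition dist (p q : point) : R := inf [set l | polygonal p q l]%classic.

Definition norm_pt (z : point) : R := dist (Vertex 1%g) z.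

Definition Sph (r : R) : set point := [set z | norm_pt z = r]%classic.
Definition cball (r : R) : set point := [set z | norm_pt z <= r]%classic.

(* An edge traversed from its source to its target (true) or backwards
   (false). *)
Definition start (x : edge * bool) : G :=
  if x.2 then edge_src x.1 else edge_tgt x.1.
Definition stop (x : edge * bool) : G :=
  if x.2 then edge_tgt x.1 else edge_src x.1.

Fixpoint edge_path (u : point) (s : seq (edge * bool)) (v : point) : Prop :=
  if s is x :: s' then u = Vertex (start x) /\ edge_path (Vertex (stop x)) s' v
  else u = v.

(* All points of the path, including those interior to its edges. *)
Definition path_points (u : point) (s : seq (edge * bool)) : set point :=
  [set z | z = u \/
     exists (x : edge * bool) (y : R), x \in s /\ on_edge x.1 y z]%classic.

(* The truncated subtraction in 2 * x - 1 (see MAC) is harmless, since x > r0.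
   Integers r > r0 > 0 are taken in nat. *)
Definition almost_convex (f : nat -> nat) (r0 : nat) : Prop :=
  forall (r : nat) (u v : point), (r0 < r)%N ->
    Sph r%:R u -> Sph r%:R v -> dist u v <= 2 ->
    exists s : seq (edge * bool),
      [/\ edge_path u s v, (path_points u s `<=` cball r%:R)%classic
        & (size s <= f r)%N].

Definition MAC : Prop :=
  exists r0 : nat, (0 < r0)%N /\ almost_convex (fun x => 2 * x - 1)%N r0.

End Cayley.

Inductive letter := La | Lb | Lc | Lt.

Definition letter_code (x : letter) : 'I_4 :=
  match x with
  | La => @Ordinal 4 0 isT | Lb => @Ordinal 4 1 isT
  | Lc => @Ordinal 4 2 isT | Lt => @Ordinal 4 3 isT
  end.

Definition letter_decode (i : 'I_4) : letter := nth La [:: La; Lb; Lc; Lt] i.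

Lemma letter_codeK : cancel letter_code letter_decode.
Proof. by case. Qed.

HB.instance Definition _ := Countable.copy letter (can_type letter_codeK).

Definition pos_word (s : seq letter) : word letter := [seq (x, true) | x <- s].

Definition G_rels : seq (word letter * word letter) :=
  [:: (pos_word [:: La; Lc], pos_word [:: Lc; La]);
      (pos_word [:: Lb; Lc], pos_word [:: Lc; Lb]);
      (pos_word [:: La; Lc; Lt], pos_word [:: Lt; La; Lc]);
      (pos_word [:: Lb; Lc; Lt], pos_word [:: Lt; Lb; Lc])].

Definition G : groupType := presented G_rels.

Definition a : G := pres_gen G_rels La.
Definition b : G := pres_gen G_rels Lb.
Definition c : G := pres_gen G_rels Lc.
Definition t : G := pres_gen G_rels Lt.

Definition S2 : {fset G} := [fset a; b; c; t]%fset.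

Lemma S2_generating : generating S2.
Proof.
move=> g.
have genS i : pres_gen G_rels i \in S2 by case: i; rewrite !inE eqxx ?orbT.
have [w ->] := eval_word_surj g.
elim: w => [|[i e] w [s IH]]; first by exists [::]; rewrite big_nil.
exists (([` genS i]%fset, e) :: s).
rewrite big_cons -IH -cat1s eval_cat /=; congr (_ * _)%g.
case: e => //; apply: (@mulgI G (pres_gen G_rels i)); rewrite mulgV.
have -> : (pres_gen G_rels i * eval_word G_rels [:: (i, false)])%g
  = eval_word G_rels [:: (i, true); (i, false)].
  by rewrite -(cat1s (i, true)) eval_cat.
apply/eval_wordP; exact: (pres_cancel _ i true).
Qed.

(* Main.v *)
Require Import Defs.
From mathcomp Require Import all_boot all_order all_algebra finmap.
From mathcomp Require Import boolp classical_sets reals.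
From mathcomp Require Import zify.

(** Put x = ac and y = bc. The four relations say that c and t both commute
    with x and y, so the group is the product of the free groups F(x, y) and
    F(c, t), in which a = (x, c^-1) and b = (y, c^-1). An element is thus a pair
    (g, h) of reduced words, and every generator changes exactly one of three
    quantities, by one: the length of g, the exponent sum E of c in a word over
    a, b, c, t, and the exponent sum of t. Hence
    [weight] = |g| + |E| + |exponent of t| bounds the norm from below.

    For n > 0 let v = a^n b^-n = (x^n y^-n, 1) and
    u = t a^n b^-(n-1) = (x^n y^-(n-1), t c^-1). Both have weight 2n and are
    spelled by words of length 2n, so they lie on the sphere of radius r = 2n;
    moreover u b^-1 t^-1 = v, because t commutes with
    a^n b^-n = (ac)^n (bc)^-n. Multiplication by a generator moves h to itself or
    to a neighbour in the tree of F(c, t), where the edge between 1 and t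
    separates the h of u from that of v. So every edge path from u to v goes from
    some (g, t) to (g, 1), with the same g ([edge_path_crossing],
    [step_starts_t]).

    If x^n is a prefix of g, then |g| + |E| >= 2n ([beyond_axis]) and (g, t),
    whose weight is one more, lies outside the ball of radius 2n. If not, then
    (g, t) and (g, 1) are far from u and v: the potential formed of the distance
    in the tree of F(x, y) from g to x^n y^-n, plus |E|, is 1-Lipschitz, equals 1
    at u and 0 at v, and is at least 2n at both ends of the crossed edge
    ([tree_dist_far]). The path then has length at least
    (2n - 1) + 1 + 2n = 2r, which exceeds 2r - 1. Since n is arbitrary, no r0
    works. *)

Set Implicit Arguments.
Unset Strict Implicit.
Unset Printing Implicit Defensive.

Import Order.TTheory GRing.Theory Num.Theory.

Local Open Scope ring_scope.

(** * Reduced words *)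

Section ReducedWords.

Variable I : eqType.

Definition linv (l : I * bool) : I * bool := (l.1, ~~ l.2).

Lemma linvK : involutive linv.
Proof. by case=> i e; rewrite /linv /= negbK. Qed.

(** Right multiplication by a letter, on elements of the free group written as
    reduced words with their last letter first: the letter that can cancel is
    then the head of the list, and prefixes of the word are suffixes of the
    list. *)
Definition push (s : word I) (l : I * bool) : word I :=
  if s is k :: s' then if k == linv l then s' else l :: s else [:: l].

Definition reduced (s : word I) : bool :=
  sorted (fun l k => k != linv l) s.

Lemma push_reduced s l : reduced s -> reduced (push s l).
Proof.
case: s => [|k s] //= red_s; case: ifP => [_|/negbT nk].
  exact: path_sorted red_s.
by rewrite /reduced /= nk.
Qed.

(** Without reducedness this fails: if s starts with linv l followed by l, the
    first push leaves a list with head l, which the second one shortens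
    again. *)
Lemma push_linv s l : reduced s -> push (push s l) (linv l) = s.
Proof.
case: s => [|k s] /=; first by rewrite linvK eqxx.
case: eqP => [->|_] red_s; last by rewrite /= linvK eqxx.
case: s red_s => [|k' s] //= /andP[nk' _].
by rewrite (negbTE nk').
Qed.

Definition expsum (P : pred I) (s : word I) : int :=
  \sum_(l <- s | P l.1) (if l.2 then 1 else -1).

(** A push that cancels adds as much as one that does not, so exponent sums
    of elements can be followed letter by letter, without reference to reduced
    forms. *)
Lemma expsum_push P s l :
  expsum P (push s l) = expsum P s + expsum P [:: l].
Proof.
rewrite /expsum big_cons big_nil addr0.
case: s => [|k s] /=; first by rewrite big_cons !big_nil; case: ifP; lia.
case: eqP => [->|_]; rewrite !big_cons /=.
  by case: (P l.1); case: (l.2) => /=; lia.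
by case: (P l.1) => /=; lia.
Qed.

End ReducedWords.

(** * The group as a product of two free groups *)

(** In the first component La and Lb stand for ac and bc, not for a and b;
    the second component is a word in c and t. *)
Definition state : Type := (word letter * word letter)%type.

Definition step (z : state) (l : letter * bool) : state :=
  match l.1 with
  | La | Lb => (push z.1 l, push z.2 (Lc, ~~ l.2))
  | Lc | Lt => (z.1, push z.2 l)
  end.

Definition run (z : state) (w : word letter) : state := foldl step z w.

Lemma run_cat z u v : run z (u ++ v) = run (run z u) v.
Proof. exact: foldl_cat. Qed.

Definition reduced_state (z : state) : bool := reduced z.1 && reduced z.2.

Lemma step_reduced z l : reduced_state z -> reduced_state (step z l).
Proof.
by case: l => [[] e] /andP[r1 r2]; apply/andP; split=> //=; exact: push_reduced.
Qed.

Lemma run_reduced z w : reduced_state z -> reduced_state (run z w).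
Proof. by elim: w z => //= l w IH z rz; apply/IH/step_reduced. Qed.

Lemma step_linv z l : reduced_state z -> step (step z l) (linv l) = z.
Proof.
case: z => g h; case: l => [i e] /andP[/= rg rh].
by case: i; rewrite /step /= ?push_linv // -{2}[(Lc, ~~ e)]/(linv (Lc, e))
  -[(Lc, ~~ ~~ e)]/(linv (Lc, ~~ e)) push_linv.
Qed.

(** The relations hold in the product of free groups: this is what makes the
    pair of reduced words an invariant of the group element. *)
Lemma run_eq u v : pres_eq G_rels u v ->
  forall z, reduced_state z -> run z u = run z v.
Proof.
elim=> {u v} [//|u v _ IH z rz|u v w _ IH1 _ IH2 z rz|u1 v1 u2 v2 _ IH1 _ IH2 z rz
  |i e z rz|u v].
- by rewrite IH.
- by rewrite IH1 // IH2.
- rewrite !run_cat IH1 // IH2 //; exact: run_reduced.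
- exact: step_linv.
have cV h : reduced h -> push (push h (Lc, false)) (Lc, true) = h.
  exact: (@push_linv _ h (Lc, false)).
have Vc h : reduced h -> push (push h (Lc, true)) (Lc, false) = h.
  exact: (@push_linv _ h (Lc, true)).
rewrite !inE => /or4P[] /eqP[-> ->] [g h] /andP[/= rg rh];
  by rewrite /run /= /step /= ?cV ?Vc ?push_reduced.
Qed.

Definition coord (z : G) : state := run ([::], [::]) (repr z).

Lemma coord_eval w : coord (eval_word G_rels w) = run ([::], [::]) w.
Proof. by apply: run_eq => //; exact: repr_eval. Qed.

Lemma eval_catG u v :
  eval_word G_rels (u ++ v) = (eval_word G_rels u * eval_word G_rels v)%g :> G.
Proof. exact: eval_cat. Qed.

Lemma coord_gen z i : coord (z * pres_gen G_rels i)%g = step (coord z) (i, true).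
Proof.
have [w ->] := eval_word_surj z.
by rewrite -eval_catG !coord_eval run_cat.
Qed.

Lemma S2_gen (s : S2) : exists i, val s = pres_gen G_rels i.
Proof.
case: s => s /=; rewrite !inE => /orP[/orP[/orP[]|]|] /eqP ->.
- by exists La.
- by exists Lb.
- by exists Lc.
- by exists Lt.
Qed.

Lemma coord_edge (e : edge S2) :
  exists i, coord (edge_tgt e) = step (coord (edge_src e)) (i, true).
Proof.
by case: (S2_gen e.2) => i si; exists i; rewrite /edge_tgt si coord_gen.
Qed.

(** * Integer potentials *)

(** The exponent sum of c in any word for z: a, b and t do not contribute, since
    La and Lb stand for ac and bc in the first coordinate. *)
Definition cexp (z : state) : int :=
  expsum predT z.1 + expsum (pred1 Lc) z.2.

Definition texp (z : state) : int := expsum (pred1 Lt) z.2.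

Lemma cexp_step z l :
  cexp (step z l) = cexp z + expsum (pred1 Lc) [:: l].
Proof.
case: z => g h; case: l => [[] e]; rewrite /cexp /step /= ?expsum_push;
  rewrite /expsum !big_cons !big_nil /=; case: e => /=; lia.
Qed.

Lemma texp_step z l :
  texp (step z l) = texp z + expsum (pred1 Lt) [:: l].
Proof.
case: z => g h; case: l => [[] e]; rewrite /texp /step /= ?expsum_push;
  rewrite /expsum !big_cons !big_nil /=; case: e => /=; lia.
Qed.

Lemma size_push (I : eqType) (s : word I) l :
  `|(size (push s l))%:Z - (size s)%:Z| <= 1.
Proof. by case: s => [|k s] //=; case: ifP => _ /=; lia. Qed.

(** A lower bound for the word norm: a and b change only the length of the
    first component, c only its own exponent sum, and t only its own. *)
Definition weight (z : state) : int :=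
  (size z.1)%:Z + `|cexp z| + `|texp z|.

Lemma weight_step z i : `|weight (step z (i, true)) - weight z| <= 1.
Proof.
rewrite /weight cexp_step texp_step /expsum !big_cons !big_nil /=.
have := size_push z.1 (i, true).
by case: i; rewrite /step /=; lia.
Qed.

(** The axis of x = ac is the ray 1, x, ..., x^n in the tree of F(x, y). As the
    bottom of a list is the beginning of the word, the test says that s is x^k
    with k <= n, or has x^n as a prefix. *)
Definition on_axis (n : nat) (s : word letter) : bool :=
  all (pred1 (La, true)) (drop (size s - n) s).

(** Measured from the point x^n y^-n at distance 2n from 1: each letter of a
    reduced word brings one closer while it follows the axis, and takes one
    further away once it has left it. Past x^n every letter is counted as an
    approach, which is right along y^-n and elsewhere gives only a lower bound
    for the distance. The recursion on prefixes makes the function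
    1-Lipschitz by construction. *)
Fixpoint tree_dist (n : nat) (s : word letter) : int :=
  if s is _ :: s' then tree_dist n s' + (if on_axis n s then -1 else 1)
  else (2 * n)%:Z.

Lemma tree_dist_push n s l : `|tree_dist n (push s l) - tree_dist n s| <= 1.
Proof.
by case: s => [|k s] /=; repeat case: ifP => _ /=; lia.
Qed.

Definition potential (n : nat) (z : state) : int := tree_dist n z.1 + `|cexp z|.

Lemma potential_step n z i :
  `|potential n (step z (i, true)) - potential n z| <= 1.
Proof.
rewrite /potential cexp_step /expsum big_cons big_nil /=.
have := tree_dist_push n z.1 (i, true).
by case: i; rewrite /step /=; lia.
Qed.

Lemma on_axis_cons_short n l s : (size s < n)%N ->
  on_axis n (l :: s) = (l == (La, true)) && on_axis n s.
Proof.
move=> ltn; rewrite /on_axis.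
have [-> ->] : (size s - n = 0 /\ size (l :: s) - n = 0)%N by rewrite /=; lia.
by rewrite !drop0.
Qed.

Lemma on_axis_cons_long n l s : (n <= size s)%N ->
  on_axis n (l :: s) = on_axis n s.
Proof. by move=> len; rewrite /on_axis /= subSn. Qed.

Definition total (s : word letter) : int := expsum predT s.

Lemma total_cons l s : total (l :: s) = (if l.2 then 1 else -1) + total s.
Proof. by rewrite /total /expsum big_cons. Qed.

(** Each of the n letters x at the start contributes 1 to both terms, and a
    later letter contributes 1 to the length and at least -1 to the sum. *)
Lemma beyond_axis n s : (n <= size s)%N -> on_axis n s ->
  (2 * n)%:Z <= (size s)%:Z + total s.
Proof.
elim: n s => [|n IHn] s.
  move=> _ _; elim: s => [|l s IH]; first by rewrite /total /expsum big_nil.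
  by rewrite total_cons /=; case: l.2; lia.
elim: s => [|l s IHs] // lens axs.
rewrite total_cons.
have [lts|les] := leqP (size s) n.
  move: axs; rewrite on_axis_cons_short // => /andP[/eqP-> axs] /=.
  have eqs : size s = n by move: lens; rewrite /=; lia.
  have := IHn s; rewrite eqs leqnn => /(_ isT).
  have -> : on_axis n s.
    by move: axs; rewrite /on_axis eqs subnn (_ : (n - n.+1 = 0)%N) //; lia.
  by move=> /(_ isT); lia.
have := IHs les; rewrite -(on_axis_cons_long l les) => /(_ axs).
by rewrite /=; case: l.2; lia.
Qed.

(** Along the axis the distance drops by 1 as the exponent sum grows by 1; off
    the axis the distance grows by 1 and the sum drops by at most 1. So the
    value 2n at the empty word is never undercut. *)
Lemma tree_dist_far n s : ~~ ((n <= size s)%N && on_axis n s) ->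
  (2 * n)%:Z <= tree_dist n s + total s.
Proof.
elim: s => [|l s IH]; first by rewrite /total /expsum big_nil addr0.
rewrite total_cons [tree_dist _ _]/= [size _]/=.
have [lts|les] := ltnP (size s) n.
  have {}IH : (2 * n)%:Z <= tree_dist n s + total s by apply: IH; rewrite leqNgt lts.
  case: ifP => [|_ _]; last by case: l.2; lia.
  by rewrite on_axis_cons_short // => /andP[/eqP-> _] _ /=; lia.
rewrite on_axis_cons_long // (leq_trans les (leqnSn _)) /=.
case: ifP => // axF _; have := IH; rewrite axF andbF => /(_ isT).
by case: l.2; lia.
Qed.

(** * Lipschitz functions on Cayley graphs *)

Section Lipschitz.

Variables (R : realType) (G : groupType) (S : {fset G}) (phi : G -> int).
Hypothesis phi_lip : forall e : edge S, `|phi (edge_tgt e) - phi (edge_src e)| <= 1.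

(** The distance is an infimum over paths that may turn inside edges, so a
    function on vertices must be extended to all points, affinely on each edge,
    to bound it. *)
Definition interpolate (p : Defs.point R S) : R :=
  match p with
  | Vertex g => (phi g)%:~R
  | Interior e y =>
      (phi (edge_src e))%:~R
      + sval y * ((phi (edge_tgt e))%:~R - (phi (edge_src e))%:~R)
  end.

Lemma interpolate_on_edge e (y : R) p : on_edge e y p ->
  interpolate p = (phi (edge_src e))%:~R
      + y * ((phi (edge_tgt e))%:~R - (phi (edge_src e))%:~R).
Proof.
case: p => [g|e' y'] /=; last by case=> -> ->.
by case=> [[-> ->]|[-> ->]]; rewrite ?mul0r ?addr0 // mul1r addrC subrK.
Qed.

Lemma polygonal_lip p q (l : R) : @polygonal R G S p q l ->
  `|interpolate q - interpolate p| <= l.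
Proof.
elim=> [|{}q q' e y z {}l _ IH eq eq']; first by rewrite subrr normr0.
rewrite -(subrK (interpolate q) (interpolate q')) -addrA addrC.
apply: le_trans (ler_normD _ _) _; apply: lerD IH _.
rewrite (interpolate_on_edge eq) (interpolate_on_edge eq') opprD addrACA subrr add0r.
rewrite -mulrBl normrM ler_piMr // -rmorphB -intr_norm -[1]/(1%:~R).
by rewrite ler_int.
Qed.

Lemma polygonal_ge0 p q (l : R) : @polygonal R G S p q l -> 0 <= l.
Proof. by elim=> // *; rewrite addr_ge0. Qed.

Lemma dist_le_polygonal (p q : Defs.point R S) l : polygonal p q l -> dist p q <= l.
Proof.
move=> pql; apply: (@ge_inf _ [set l | polygonal p q l]%classic) => //.
by exists 0 => m /polygonal_ge0.
Qed.

(** The given path ensures that the infimum is not taken over the empty set,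
    where it would be 0. *)
Lemma lip_le_dist g h (l : R) : polygonal (Vertex R S g) (Vertex R S h) l ->
  `|phi h - phi g|%:~R <= dist (Vertex R S g) (Vertex R S h).
Proof.
move=> ghl; apply: lb_le_inf; first by exists l.
by move=> m /polygonal_lip /=; rewrite intr_norm rmorphB.
Qed.

Lemma edge_path_lip g s h : edge_path (Vertex R S g) s (Vertex R S h) ->
  `|phi h - phi g| <= (size s)%:Z.
Proof.
elim: s g => [|[e b] s IH] g /=; first by case=> ->; rewrite subrr.
case=> -[->] /IH; have := phi_lip e.
by case: b; rewrite /start /stop /=; lia.
Qed.

End Lipschitz.

Lemma edge_path_crossing (R : realType) (G : groupType) (S : {fset G})
    (P : G -> bool) g s h :
  edge_path (Vertex R S g) s (Vertex R S h) -> P g -> ~~ P h ->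
  exists s1 e s2, [/\ s = s1 ++ e :: s2, P (start e), ~~ P (stop e),
    edge_path (Vertex R S g) s1 (Vertex R S (start e))
    & edge_path (Vertex R S (stop e)) s2 (Vertex R S h)].
Proof.
elim: s g => [|e s IH] g /=; first by case=> -> ->.
case=> -[->] sP Pg Ph; case Pe: (P (stop e)).
  have [s1 [e' [s2 [-> Ps Ps' p1 p2]]]] := IH _ sP Pe Ph.
  by exists (e :: s1), e', s2; split.
by exists [::], e, s; rewrite Pe; split.
Qed.

Lemma polygonal_word (R : realType) g w :
  polygonal (Vertex R S2 g) (Vertex R S2 (g * eval_word G_rels w)%g) (size w)%:R.
Proof.
elim/last_ind: w => [|w [i e] IH].
  have -> : eval_word G_rels [::] = 1%g :> G by [].
  by rewrite mulg1; exact: polygonal_nil.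
have genS : pres_gen G_rels i \in S2 by case: i; rewrite !inE eqxx ?orbT.
rewrite size_rcons -cats1 eval_catG mulgA -natr1.
set z := (g * _)%g in IH *.
case: e.
  have -> : (size w)%:R + 1 = (size w)%:R + `|1 - 0| :> R by rewrite subr0 normr1.
  by apply: (polygonal_rcons (e := (z, [` genS]%fset)) IH) => /=; [left | right].
have -> : (size w)%:R + 1 = (size w)%:R + `|0 - 1| :> R.
  by rewrite sub0r normrN normr1.
pose z' : G := (z * eval_word G_rels [:: (i, false)])%g.
apply: (polygonal_rcons (e := (z', [` genS]%fset)) IH) => /=; last by left.
right; split=> //; rewrite /edge_tgt /= /z' -mulgA.
rewrite (_ : (_ * pres_gen _ i)%g = 1%g :> G) ?mulg1 //.
rewrite -[LHS](eval_catG [:: (i, false)] [:: (i, true)]).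
by apply/eval_wordP; exact: (pres_cancel _ i false).
Qed.

(** * The two points *)

(** The hypothesis keeps the letters c^-1 that come with a from cancelling
    in h. *)
Lemma run_nseq_a k h : ohead h != Some (Lc, true) ->
  run ([::], h) (nseq k (La, true))
  = (nseq k (La, true), nseq k (Lc, false) ++ h).
Proof.
move=> nh; elim: k => [//|k IH].
rewrite -addn1 [X in run _ X]nseqD run_cat IH addn1 /=.
rewrite /step /=; congr (_, _); first by case: k {IH}.
by case: k {IH} => [|k] //=; case: h nh => [|l h] //= nh; rewrite ifN.
Qed.

Lemma run_nseq_b n k j h :
  run (nseq n (La, true), nseq (k + j) (Lc, false) ++ h) (nseq k (Lb, false))
  = (nseq k (Lb, false) ++ nseq n (La, true), nseq j (Lc, false) ++ h).
Proof.
elim: k j => [//|k IH] j.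
rewrite -{2}addn1 [X in run _ X]nseqD run_cat addSnnS IH /=.
rewrite /step /=; congr (_, _).
by case: k {IH} => [|k] //=; case: n.
Qed.

Definition top_word (n : nat) : word letter :=
  nseq n (La, true) ++ nseq n (Lb, false).

(** The index is one less than that of the matching [top_word], which spares a
    predecessor. *)
Definition side_word (n : nat) : word letter :=
  (Lt, true) :: nseq n.+1 (La, true) ++ nseq n (Lb, false).

Lemma run_top n : run ([::], [::]) (top_word n)
  = (nseq n (Lb, false) ++ nseq n (La, true), [::]).
Proof.
rewrite /top_word run_cat run_nseq_a // cats0.
by have := run_nseq_b n n 0 [::]; rewrite addn0 cats0.
Qed.

Lemma run_side n : run ([::], [::]) (side_word n)
  = (nseq n (Lb, false) ++ nseq n.+1 (La, true), [:: (Lc, false); (Lt, true)]).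
Proof.
rewrite /side_word -cat1s run_cat [run _ [:: _]]/=.
rewrite [step _ _]/= run_cat run_nseq_a //.
by have := run_nseq_b n.+1 n 1 [:: (Lt, true)]; rewrite addn1.
Qed.

Lemma total_nseq_ba j k :
  total (nseq j (Lb, false) ++ nseq k (La, true)) = k%:Z - j%:Z.
Proof.
elim: j => [|j IH]; last by rewrite total_cons IH /=; lia.
elim: k => [|k IH]; first by rewrite /total /expsum big_nil.
by rewrite total_cons IH /=; lia.
Qed.

Lemma tree_dist_nseq n j :
  tree_dist n (nseq j (Lb, false) ++ nseq n (La, true)) = n%:Z - j%:Z.
Proof.
have axis k : (k <= n)%N -> tree_dist n (nseq k (La, true)) = (2 * n)%:Z - k%:Z /\
    on_axis n (nseq k (La, true)).
  elim: k => [|k IH] le; first by split=> //=; lia.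
  have [tk ak] := IH (ltnW le).
  have ak' : on_axis n (nseq k.+1 (La, true)).
    by rewrite [nseq _ _]/= on_axis_cons_short ?size_nseq // eqxx.
  by split=> //; move: ak'; rewrite /= => ->; rewrite tk; lia.
suff [] : tree_dist n (nseq j (Lb, false) ++ nseq n (La, true)) = n%:Z - j%:Z
  /\ on_axis n (nseq j (Lb, false) ++ nseq n (La, true)) by [].
elim: j => [|j [tj aj]]; first by have [-> ->] := axis n (leqnn n); split=> //; lia.
have aj' : on_axis n (nseq j.+1 (Lb, false) ++ nseq n (La, true)).
  by rewrite [_ ++ _]/= on_axis_cons_long // size_cat !size_nseq leq_addl.
by split=> //; move: aj'; rewrite /= => ->; rewrite tj; lia.
Qed.

Lemma cexp_top n : cexp (coord (eval_word G_rels (top_word n))) = 0.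
Proof.
rewrite coord_eval run_top /cexp /= -/(total _) total_nseq_ba subrr.
by rewrite /expsum big_nil.
Qed.

Lemma cexp_side n : cexp (coord (eval_word G_rels (side_word n))) = 0.
Proof.
rewrite coord_eval run_side /cexp -/(total _) total_nseq_ba.
by rewrite /expsum !big_cons big_nil /=; lia.
Qed.

(** * The edge that must be crossed *)

(** The default of [last] only needs to differ from (Lt, true), so that the
    empty word does not count as starting with t. *)
Definition starts_t (z : state) : bool := last (La, true) z.2 == (Lt, true).

(** The beginning of a word lies at the far end of the list, out of reach of a
    push unless the list has at most one element: in the tree of a free group,
    the edge between 1 and m alone separates the words that start with m from
    the others. *)
Lemma last_push (I : eqType) (d m l : I * bool) h : d != m ->
  (last d (push h l) == m) != (last d h == m) ->
  h = [::] /\ l = m \/ h = [:: m] /\ l = linv m.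
Proof.
move=> dm; case: h => [|k h] /=.
  by rewrite (negbTE dm) eqbF_neg negbK => /eqP; left.
case: (k =P linv l) => [->|_]; last by rewrite eqxx.
case: h => [|k' h] /=; last by rewrite eqxx.
rewrite (negbTE dm) eq_sym eqbF_neg negbK => /eqP <-; right.
by rewrite linvK.
Qed.

Lemma step_starts_t z i : starts_t (step z (i, true)) != starts_t z ->
  z.2 = [::] /\ step z (i, true) = (z.1, [:: (Lt, true)]).
Proof.
case: z => g h; rewrite /starts_t.
by case: i => /= /last_push-/(_ isT) [] [] // ->.
Qed.

(** * The failure of minimal almost convexity *)

Lemma rel_eval u v : (u, v) \in G_rels ->
  eval_word G_rels u = eval_word G_rels v :> G.
Proof. by move=> uv; apply/eval_wordP; exact: pres_rel. Qed.

Lemma eval_nseq i e n :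
  eval_word G_rels (nseq n (i, e)) = (eval_word G_rels [:: (i, e)] ^+ n)%g :> G.
Proof.
elim: n => [|n IH]; first by rewrite expg0.
by rewrite expgS -IH -eval_catG.
Qed.

(** The word a^n b^-n equals (ac)^n (bc)^-n, because c commutes with a and b,
    and t commutes with ac and bc. *)
Lemma commute_t_top n : commute t (eval_word G_rels (top_word n) : G).
Proof.
have ac : commute a c.
  by rewrite /commute -!eval_catG; apply: rel_eval; rewrite !inE ?eqxx.
have bc : commute b c.
  by rewrite /commute -!eval_catG; apply: rel_eval; rewrite !inE ?eqxx ?orbT.
have t_ac : commute t (a * c)%g.
  rewrite -[(a * c)%g](eval_catG [:: (La, true)] [:: (Lc, true)]).
  rewrite /commute -!eval_catG; apply/esym/rel_eval.
  by rewrite !inE ?eqxx ?orbT.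
have t_bc : commute t (b * c)%g.
  rewrite -[(b * c)%g](eval_catG [:: (Lb, true)] [:: (Lc, true)]).
  rewrite /commute -!eval_catG; apply/esym/rel_eval.
  by rewrite !inE ?eqxx ?orbT.
have bV : eval_word G_rels [:: (Lb, false)] = b^-1%g :> G.
  apply: (@mulgI G b); rewrite mulgV -[LHS]eval_catG.
  by apply/eval_wordP; exact: (pres_cancel _ Lb true).
have -> : eval_word G_rels (top_word n) = ((a * c) ^+ n * ((b * c) ^+ n)^-1)%g :> G.
  rewrite eval_catG !eval_nseq bV expVgn !expgMn // invgM mulgA mulgK //.
by apply: commuteM; [exact: commuteX | apply/commuteV/commuteX].
Qed.

(** Both points are neighbours of the product of t and [top_word], in either
    order: cancelling the last b^-1 gives one, cancelling t the other. *)
Lemma side_top n :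
  eval_word G_rels (top_word n.+1)
  = (eval_word G_rels (side_word n)
     * eval_word G_rels [:: (Lb, false); (Lt, false)])%g :> G.
Proof.
have split_side : side_word n ++ [:: (Lb, false); (Lt, false)]
    = [:: (Lt, true)] ++ top_word n.+1 ++ [:: (Lt, false)].
  have snoc : nseq n.+1 (Lb, false) = nseq n (Lb, false) ++ [:: (Lb, false)].
    by rewrite -addn1 nseqD.
  by rewrite /side_word /top_word snoc /= -!catA.
rewrite -eval_catG split_side.
rewrite (eval_catG [:: (Lt, true)]) (eval_catG (top_word n.+1)) mulgA.
rewrite -[eval_word _ [:: (Lt, true)]]/t commute_t_top -mulgA.
rewrite (_ : (t * _)%g = 1%g :> G) ?mulg1 //.
rewrite -[LHS](eval_catG [:: (Lt, true)] [:: (Lt, false)]).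
by apply/eval_wordP; exact: (pres_cancel _ Lt true).
Qed.

Lemma edge_lip (phi : state -> int) :
  (forall z i, `|phi (step z (i, true)) - phi z| <= 1) ->
  forall e : edge S2, `|phi (coord (edge_tgt e)) - phi (coord (edge_src e))| <= 1.
Proof. by move=> lip e; have [i ->] := coord_edge e. Qed.

Lemma weight1 : weight (coord 1%g) = 0.
Proof.
have -> : coord 1%g = ([::], [::]).
  by rewrite -[1%g]/(eval_word G_rels [::]) coord_eval.
by rewrite /weight /cexp /texp /expsum !big_nil.
Qed.

Lemma weight_le_norm (R : realType) z :
  (weight (coord z))%:~R <= norm_pt (Vertex R S2 z).
Proof.
have [w zw] := eval_word_surj z.
have := polygonal_word R 1%g w; rewrite mul1g -zw.
move=> /(lip_le_dist (phi := weight \o coord) (edge_lip weight_step)).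
by rewrite /= weight1 subr0 ger0_norm.
Qed.

Lemma norm_eval (R : realType) w :
  weight (coord (eval_word G_rels w)) = (size w)%:Z ->
  norm_pt (Vertex R S2 (eval_word G_rels w)) = (size w)%:R.
Proof.
move=> ww; apply/eqP; rewrite eq_le; apply/andP; split.
  by have := polygonal_word R 1%g w; rewrite mul1g => /dist_le_polygonal.
by rewrite -[_%:R]/((size w)%:Z%:~R) -ww weight_le_norm.
Qed.

Lemma weight_top n :
  weight (coord (eval_word G_rels (top_word n))) = (size (top_word n))%:Z.
Proof.
rewrite /weight cexp_top coord_eval run_top /texp /expsum big_nil /=.
by rewrite /top_word !size_cat !size_nseq; lia.
Qed.

Lemma weight_side n :
  weight (coord (eval_word G_rels (side_word n))) = (size (side_word n))%:Z.
Proof.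
rewrite /weight cexp_side coord_eval run_side /texp /expsum !big_cons big_nil /=.
by rewrite !size_cat /= !size_nseq; lia.
Qed.

Lemma potential_top n : potential n (coord (eval_word G_rels (top_word n))) = 0.
Proof.
by rewrite /potential cexp_top coord_eval run_top /= tree_dist_nseq subrr.
Qed.

Lemma potential_side n :
  potential n.+1 (coord (eval_word G_rels (side_word n))) = 1.
Proof.
rewrite /potential cexp_side coord_eval run_side /fst tree_dist_nseq.
by rewrite normr0 addr0; lia.
Qed.

Theorem theorem3p7 (R : realType) : ~ MAC R S2.
Proof.
case=> r0 [_ convex].
(* The sphere has radius 2n, which is greater than r0. *)
set n := r0.+1; pose r := (2 * n)%N.
set u := eval_word G_rels (side_word r0) : G.
set v := eval_word G_rels (top_word n) : G.
have sphu : Sph r%:R (Vertex R S2 u).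
  rewrite /Sph /= norm_eval ?weight_side //; congr _%:R.
  by rewrite /= size_cat !size_nseq /r /n; lia.
have sphv : Sph r%:R (Vertex R S2 v).
  rewrite /Sph /= norm_eval ?weight_top //; congr _%:R.
  by rewrite size_cat !size_nseq /r; lia.
have duv : dist (Vertex R S2 u) (Vertex R S2 v) <= 2.
  apply: dist_le_polygonal; rewrite /v side_top.
  exact: (polygonal_word R u [:: (Lb, false); (Lt, false)]).
have ltr : (r0 < r)%N by rewrite /r /n; lia.
have [s [uv_path inball size_s]] := convex r _ _ ltr sphu sphv duv.
have tu : starts_t (coord u) by rewrite /u coord_eval run_side.
have tv : ~~ starts_t (coord v) by rewrite /v coord_eval run_top.
have [s1 [[e dir] [s2 [def_s te te' path1 path2]]]] :=
  edge_path_crossing (P := fun z => starts_t (coord z)) uv_path tu tv.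
have [i tgt_e] := coord_edge e.
(* Multiplying by a generator can only create an initial t; since the path
   loses it here, the edge is run along backwards. *)
have cross : starts_t (coord (edge_tgt e)) != starts_t (coord (edge_src e)).
  by move: te te'; case: dir {def_s path1 path2} => /=; rewrite /start /stop /=;
    do 2![case: (starts_t _) => //].
move: (cross); rewrite {1}tgt_e => /step_starts_t; rewrite -tgt_e.
case src_e: (coord (edge_src e)) => [g h] /= [h0 {}tgt_e].
rewrite {}h0 in src_e.
have dirF : dir = false.
  by case: dir te {def_s te' path1 path2} => //; rewrite /start /= src_e.
rewrite {}dirF in def_s te te' path1 path2.
rewrite /start /stop /= in path1 path2.
have cexp_g : cexp (g, [::]) = total g /\ cexp (g, [:: (Lt, true)]) = total g.
  by rewrite /cexp /= -/(total g) /expsum big_cons big_nil /=; split; lia.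
(* This end of the edge lies in the ball, so g does not have x^n as a prefix. *)
have : weight (g, [:: (Lt, true)]) <= r%:Z.
  have : cball (r%:R : R) (Vertex R S2 (edge_tgt e)).
    apply: inball; right; exists (e, false), 1.
    by rewrite def_s mem_cat inE eqxx orbT; split=> //=; right.
  rewrite /cball /= => /(le_trans (weight_le_norm R _)).
  by rewrite tgt_e -[r%:R]/(r%:Z%:~R) ler_int.
rewrite /weight /= cexp_g.2 [texp _]/texp /expsum big_cons big_nil /= => wgt.
have far : ~~ ((n <= size g)%N && on_axis n g).
  apply/andP=> -[len ax]; have := beyond_axis len ax; rewrite /r in wgt; lia.
have pot_g : r%:Z <= tree_dist n g + `|total g|.
  by have := tree_dist_far far; rewrite /r; lia.
(* The two parts of the path have lengths at least 2n - 1 and 2n. *)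
have pot_lip := edge_lip (potential_step n).
have := edge_path_lip (phi := potential n \o coord) pot_lip path1.
have := edge_path_lip (phi := potential n \o coord) pot_lip path2.
rewrite /= potential_side potential_top src_e tgt_e /potential /= cexp_g.1 cexp_g.2.
move: size_s; rewrite def_s size_cat /= /r; move: pot_g; rewrite /r; lia.
Qed.
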